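(* Let $0 < \lambda < \frac12$, $\gamma \ge 1$, and $\mathbf{s} \in \mathbb{R}^k$. Construct $\mathbf{n} \in \mathbb{Z}^k$ by choosing its $k$ distinct entries from $\{1,2,\dots,j\}$ uniformly at random. Then the probability that $\mathsf{Z}_{\lambda,\gamma}(\mathbf{n},\mathbf{s}) \cap \mathbb{Z}^k \ne \varnothing$, or equivalently that $\operatorname{lon}(\mathbf{n},\mathbf{s}) \ge \lambda$, tends to $1$ as $j \to \infty$.
   Context: Here $k$ is a fixed positive integer and $\gamma$ is real. The random vector $\mathbf{n}$ is uniformly distributed over the vectors in $\{1,\dots,j\}^k$ with pairwise distinct entries (for $j \ge k$). For real $x$, $\|x\|_{\mathbb{Z}}$ denotes the distance from $x$ to the nearest integer. For $\mathbf{n} = (n_1,\dots,n_k)$ a vector of positive integers and $\mathbf{s} = (s_1,\dots,s_k) \in \mathbb{R}^k$, $\operatorname{lon}(\mathbf{n},\mathbf{s}) := \max_{t\in[0,1]} \min_{1\le j\le k} \|t n_j + s_j\|_{\mathbb{Z}}$ and $\mathsf{Z}_{\lambda,\gamma}(\mathbf{n},\mathbf{s}) := \mathbf{s} + [\lambda,1-\lambda]^k + [0,\gamma]\,\mathbf{n}$ (Minkowski sum), where $[0,\gamma]\,\mathbf{n} = \{ t\mathbf{n} : 0 \le t \le \gamma\}$. *)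

(* Defs.v *)
From HB Require Import structures.
From mathcomp Require Import all_boot all_order all_algebra.
From mathcomp Require Import all_classical all_reals all_analysis.
Set Implicit Arguments.
Unset Strict Implicit.
Unset Printing Implicit Defensive.
Import Order.TTheory GRing.Theory Num.Theory.
Import numFieldNormedType.Exports.
Local Open Scope classical_set_scope.
Local Open Scope ring_scope.

Definition distZ (R : realType) (x : R) : R :=
  inf [set `|x - m%:~R| | m in [set: int]].

(* Distances to Z are at most 1/2, so for k > 0 the initial value 1/2 does not
   affect the minimum. *)
Definition min_distZ (R : realType) (k : nat) (n : 'rV[int]_k) (s : 'rV[R]_k)
    (t : R) : R :=
  \big[Num.min/2^-1]_(i < k) distZ (t * (n 0 i)%:~R + s 0 i).

(* The supremum is a maximum: min_distZ n s is continuous on the compact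
   interval [0, 1]. *)
Definition lon (R : realType) (k : nat) (n : 'rV[int]_k) (s : 'rV[R]_k) : R :=
  sup [set min_distZ n s t | t in `[0, 1]].

Definition minkowski_sum (V : zmodType) (A B : set V) : set V :=
  [set a + b | a in A & b in B].

Definition cube (R : realType) (k : nat) (a b : R) : set 'rV[R]_k :=
  [set x | forall i, x 0 i \in `[a, b]].

Definition segment (R : realType) (k : nat) (g : R) (v : 'rV[R]_k) :
    set 'rV[R]_k :=
  [set t *: v | t in `[0, g]].

Definition zonotope (R : realType) (k : nat) (lambda gamma : R)
    (n : 'rV[int]_k) (s : 'rV[R]_k) : set 'rV[R]_k :=
  minkowski_sum (minkowski_sum [set s] (cube lambda (1 - lambda)))
            (segment gamma (map_mx intr n)).

Definition integer_points (R : realType) (k : nat) : set 'rV[R]_k :=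
  range (fun m : 'rV[int]_k => map_mx intr m).

Definition distinct_vectors (k j : nat) : {set 'rV['I_j.+1]_k} :=
  [set v : 'rV['I_j.+1]_k |
    injectiveb (fun i => v ord0 i) && [forall i, (0 < v ord0 i)%N]]%SET.

Definition int_vector (k j : nat) (v : 'rV['I_j.+1]_k) : 'rV[int]_k :=
  map_mx (fun a : 'I_j.+1 => (a : nat)%:Z) v.

(* The junk value 0 / 0 = 0 only occurs for j < k. *)
Definition prob_distinct (R : realType) (k j : nat) (E : set 'rV[int]_k) : R :=
  #|[set v in distinct_vectors k j | `[< E (int_vector v) >]]%SET|%:R
    / #|distinct_vectors k j|%:R.

(* Main.v *)
Require Import Defs.
From HB Require Import structures.
From mathcomp Require Import all_boot all_order all_algebra.
From mathcomp Require Import all_classical all_reals all_analysis.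
From mathcomp Require Import complex ring lra zify.
Set Implicit Arguments.
Unset Strict Implicit.
Unset Printing Implicit Defensive.
Import Order.TTheory GRing.Theory Num.Theory.
Import numFieldNormedType.Exports.
Local Open Scope classical_set_scope.
Local Open Scope ring_scope.

(** The zonotope meets the integer lattice, and lon n s >= lambda, exactly when
    there is a lonely time: some t for which every t n_i + s_i is at distance at
    least lambda from the integers ([zonotope_integer_pointP], [lon_geP]).  So it
    suffices to find a lonely time for all but a vanishing proportion of the
    vectors n.

    The existence of a lonely time follows from a quantitative form of
    Kronecker's equidistribution theorem.  Let b(x) = (1 - cos (2 pi x)) / 2,
    which has period 1, takes values in [0, 1], and stays below
    rho = b(lambda) < 1 at distance less than lambda from the integers.  If there
    is no lonely time, then the product P(t) of the b(t n_i + s_i)^L is at most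
    rho^L for every t.  On the other hand b^L is a trigonometric polynomial of
    degree L with constant term C(2L, L) / 4^L.  If n satisfies no nontrivial
    relation sum_i m_i n_i = 0 with integer coefficients bounded by L, then
    averaging P over the multiples of 1/N, for N large, kills every frequency but
    the constant one, and the average is (C(2L, L) / 4^L)^k ([sum_prod_bump]).
    This is at least (L + 1)^(-k), which exceeds rho^L for a suitable L depending
    only on lambda and k: a contradiction ([independent_lonely]).

    It remains to count.  A nontrivial relation determines one coordinate of n
    from the others, so at most a proportion 1 / (j + 1) of all the vectors with
    entries in {0, ..., j} satisfies it ([card_relation_le]), and for fixed L
    there are boundedly many relations.  Having two equal entries or a zero entry
    is itself a relation with coefficients at most 1; hence the vectors without
    relation all have distinct positive entries, and they make up a proportion
    1 - O(1/j) of everything ([prob_distinct_ge]). *)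

(** * Distance to the integers *)

Lemma distZ_geP (R : realType) (x a : R) :
  (a <= distZ x) <-> (forall m : int, a <= `|x - m%:~R|).
Proof.
have neS : [set `|x - m%:~R| | m in [set: int]] !=set0 by exists `|x - 0%:~R|, 0.
split=> [le_ax m|le_a]; last by apply: lb_le_inf => // _ [m _ <-].
apply: le_trans le_ax _; apply: ge_inf; last by exists m.
by exists 0 => _ [i _ <-].
Qed.

Lemma distZ_lt (R : realType) (x a : R) :
  distZ x < a -> exists m : int, `|x - m%:~R| < a.
Proof.
move=> lt_xa; apply: contrapT => far; move: lt_xa; apply/negP; rewrite -leNgt.
by apply/distZ_geP => m; rewrite leNgt; apply/negP => lt_ma; apply: far; exists m.
Qed.

Lemma distZ_addz (R : realType) (x : R) (q : int) : distZ (x + q%:~R) = distZ x.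
Proof.
have le_shift (y : R) (p : int) : distZ y <= distZ (y + p%:~R).
  apply/distZ_geP => m.
  have /distZ_geP/(_ (m - p)) := lexx (distZ y).
  by rewrite rmorphB opprB addrA.
apply/eqP; rewrite eq_le le_shift andbT.
by have := le_shift (x + q%:~R) (- q); rewrite rmorphN addrK.
Qed.

(** Moving x by h moves each of the distances to integers, hence their infimum,
    by at most h. *)
Lemma distZ_lipschitz (R : realType) (x y : R) : distZ x - distZ y <= `|x - y|.
Proof.
rewrite lerBlDr -lerBlDl; apply/distZ_geP => m; rewrite lerBlDl.
have /distZ_geP/(_ m) dx := lexx (distZ x); apply: le_trans dx _.
by rewrite (le_trans _ (ler_normD _ _))// addrA subrK.
Qed.

(** Both integer neighbours of x are at least lambda away if and only if the one
    above lies between lambda and 1 - lambda away.  This turns the distance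
    condition into membership in a side of the cube. *)
Lemma distZ_geE (R : realType) (x lambda : R) :
  (lambda <= distZ x) <-> exists m : int, m%:~R - x \in `[lambda, 1 - lambda].
Proof.
split=> [/distZ_geP far|[m]].
  have /andP[fl_le lt_fl] := floor_itv x.
  exists (Num.floor x + 1); rewrite in_itv /=.
  have := far (Num.floor x); rewrite ger0_norm ?subr_ge0//.
  have := far (Num.floor x + 1); rewrite ler0_norm; last by rewrite subr_le0 ltW.
  by rewrite rmorphD rmorph1 => ? ?; apply/andP; split; lra.
rewrite in_itv /= => /andP[lo hi]; apply/distZ_geP => q.
have [le_mq|lt_qm] := leP m q.
  have : (m%:~R : R) <= q%:~R by rewrite ler_int.
  have := ler_norm (q%:~R - x); rewrite (distrC x); lra.
have : ((q + 1)%:~R : R) <= m%:~R by rewrite ler_int lezD1.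
have := ler_norm (x - q%:~R); rewrite rmorphD rmorph1; lra.
Qed.

Lemma continuous_distZ (R : realType) : continuous (@distZ R).
Proof.
move=> x; apply/cvgrPdist_le => e e0; near=> y.
have near_xy : `|x - y| <= e by near: y; apply: cvgr_dist_le.
rewrite ler_norml; have := distZ_lipschitz x y; have := distZ_lipschitz y x.
rewrite (distrC y); lra.
Unshelve. all: by end_near. Qed.

Lemma continuous_min_distZ (R : realType) (k : nat) (n : 'rV[int]_k)
  (s : 'rV[R]_k) : continuous (min_distZ n s).
Proof.
apply: continuous_big => [xy|i _ t].
  by apply: (@continuous_min R _ (fun p : R * R => p.1) (fun p => p.2));
    [exact: cvg_fst|exact: cvg_snd].
apply: (@continuous_comp _ _ _ (fun t : R => t * (n 0 i)%:~R + s 0 i)).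
  by apply: cvgD; [apply: cvgM; [exact: cvg_id|exact: cvg_cst]|exact: cvg_cst].
exact: continuous_distZ.
Qed.

(** * Lonely times, the zonotope and lon *)

Definition lonely_time (R : realType) (k : nat) (lambda : R) (n : 'rV[int]_k)
    (s : 'rV[R]_k) (t : R) : Prop :=
  forall i, lambda <= distZ (t * (n 0 i)%:~R + s 0 i).

Lemma min_distZ_geP (R : realType) (k : nat) (lambda : R) (n : 'rV[int]_k)
    (s : 'rV[R]_k) (t : R) : lambda <= 2^-1 ->
  (lambda <= min_distZ n s t) <-> lonely_time lambda n s t.
Proof.
move=> le_half; split=> [/bigmin_geP[_ far] i|far]; first exact: far.
by apply/bigmin_geP; split.
Qed.

(** The supremum defining lon is attained, since a continuous function on a
    segment has a maximum.  The bound on lambda is there because the minimum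
    over the coordinates is also taken with 1/2. *)
Lemma lon_geP (R : realType) (k : nat) (lambda : R) (n : 'rV[int]_k)
    (s : 'rV[R]_k) : lambda <= 2^-1 ->
  (lambda <= lon n s) <-> (exists2 t, t \in `[0, 1] & lonely_time lambda n s t).
Proof.
move=> le_half.
have [c c01 maxc] : exists2 c : R, c \in `[0, 1] &
    forall t : R, t \in `[0, 1] -> min_distZ n s t <= min_distZ n s c.
  by apply: EVT_max => //; apply: continuous_subspaceT; apply: continuous_min_distZ.
have -> : lon n s = min_distZ n s c.
  apply/eqP; rewrite eq_le; apply/andP; split.
    apply: ge_sup; first by exists (min_distZ n s c), c.
    by move=> _ [t t01 <-]; apply: maxc.
  apply: ub_le_sup; last by exists c.
  by exists (min_distZ n s c) => _ [t t01 <-]; apply: maxc.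
split=> [/min_distZ_geP lonely|[t t01 /min_distZ_geP lonely]].
  by exists c => //; apply: lonely.
exact: le_trans (lonely le_half) (maxc t t01).
Qed.

Lemma lonely_time_addz (R : realType) (k : nat) (lambda : R) (n : 'rV[int]_k)
    (s : 'rV[R]_k) (t : R) (q : int) :
  lonely_time lambda n s (t + q%:~R) <-> lonely_time lambda n s t.
Proof.
suff -> : lonely_time lambda n s (t + q%:~R) = lonely_time lambda n s t by [].
rewrite /lonely_time; congr (forall i, _); apply: funext => i.
by rewrite mulrDl addrAC -rmorphM distZ_addz.
Qed.

(** An integer point m = s + c + t n amounts to m_i - (t n_i + s_i) lying in
    [lambda, 1 - lambda] for all i, that is, to t being a lonely time.  Since n is
    an integer vector, the set of lonely times has period 1, so it meets
    [0, gamma] if and only if it meets [0, 1]. *)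
Lemma zonotope_integer_pointP (R : realType) (k : nat) (lambda gamma : R)
    (n : 'rV[int]_k) (s : 'rV[R]_k) : lambda <= 2^-1 -> 1 <= gamma ->
  (zonotope lambda gamma n s `&` @integer_points R k !=set0) <->
  lambda <= lon n s.
Proof.
move=> le_half le1g; apply: iff_trans (iff_sym (lon_geP n s le_half)).
split=> [[_ [[_ [_ -> [c cc <-]] [_ [t t0g <-] <-]] [m _ eqm]]]|[t t01 lonely]].
  have lonely : lonely_time lambda n s t.
    move=> i; apply/distZ_geE; exists (m 0 i).
    have /matrixP/(_ 0 i) := eqm; rewrite !mxE => ->.
    suff -> : s 0 i + c 0 i + t * (n 0 i)%:~R - (t * (n 0 i)%:~R + s 0 i) = c 0 i.
      exact: cc.
    ring.
  exists (t - (Num.floor t)%:~R); last by rewrite -rmorphN; apply/lonely_time_addz.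
  have /andP[fl_le lt_fl] := floor_itv t.
  by move: lt_fl; rewrite rmorphD rmorph1 in_itv /=; lra.
have /boolp.choice[m cube_m] i : exists m : int,
    m%:~R - (t * (n 0 i)%:~R + s 0 i) \in `[lambda, 1 - lambda].
  exact/distZ_geE.
pose p : 'rV[R]_k := map_mx intr (\row_i m i).
exists p; split; last by exists (\row_i m i).
exists (p - t *: map_mx intr n); last first.
  exists (t *: map_mx intr n); last by rewrite subrK.
  exists t => //; move: t01; rewrite /= !in_itv /= => /andP[-> t1] /=.
  exact: le_trans t1 le1g.
exists s => //; exists (p - t *: map_mx intr n - s); last by rewrite addrC subrK.
by move=> i; have := cube_m i; rewrite !mxE opprD addrA.
Qed.

(** * Characters of the circle *)

(** The character exp(2 pi i x). *)
Definition circle (R : realType) (x : R) : R[i] :=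
  (cos (x * (pi *+ 2)) +i* sin (x * (pi *+ 2)))%C.

Lemma circleD (R : realType) (x y : R) : circle (x + y) = circle x * circle y.
Proof.
rewrite /circle mulrDl cosD sinD; apply/eqP; rewrite eq_complex /=.
by rewrite eqxx /= addrC.
Qed.

Lemma circle0 (R : realType) : circle (0 : R) = 1.
Proof. by rewrite /circle mul0r cos0 sin0. Qed.

Lemma circle_neq0 (R : realType) (x : R) : circle x != 0.
Proof.
apply/eqP => c0; have := circleD x (- x).
by rewrite subrr circle0 c0 mul0r; apply/eqP/oner_neq0.
Qed.

Lemma circleN (R : realType) (x : R) : circle (- x) = (circle x)^-1.
Proof.
apply: (mulfI (circle_neq0 x)).
by rewrite -circleD subrr circle0 mulfV// circle_neq0.
Qed.

Lemma circleMn (R : realType) (x : R) (n : nat) : circle (n%:R * x) = circle x ^+ n.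
Proof.
elim: n => [|n IHn]; first by rewrite mul0r circle0.
by rewrite -natr1 mulrDl mul1r circleD IHn exprSr.
Qed.

Lemma circle_sum (R : realType) (I : finType) (F : I -> R) :
  circle (\sum_i F i) = \prod_i circle (F i).
Proof. exact: (big_morph _ (@circleD R) (@circle0 R)). Qed.

Lemma circle_int (R : realType) (m : int) : circle (m%:~R : R) = 1.
Proof.
have circle_nat (n : nat) : circle (n%:R : R) = 1.
  rewrite -[n%:R]mulr1 circleMn.
  by rewrite /circle mul1r cos2pi sin2pi expr1n.
case: m => n; first exact: circle_nat.
by rewrite NegzE rmorphN circleN circle_nat invr1.
Qed.

(** By the double angle formula, cos (2 pi x) = 1 forces sin (pi x) = 0, whereas
    the sine is positive inside (0, pi). *)
Lemma circle_neq1 (R : realType) (x : R) : 0 < `|x| < 1 -> circle x != 1.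
Proof.
move=> /andP[x0 x1]; apply/eqP => -[cos1 _].
have : cos (`|x| * pi *+ 2) = 1.
  have pi2_ge0 : 0 <= pi *+ 2 :> R by rewrite mulrn_wge0 ?pi_ge0.
  by rewrite -mulrnAr -(ger0_norm pi2_ge0) -normrM cos_norm.
rewrite cos_mulr2n => /eqP.
have : 0 < sin (`|x| * pi).
  apply: sin_gt0_pi; rewrite mulr_gt0 ?pi_gt0//=.
  by rewrite gtr_pMl ?pi_gt0.
rewrite cos2sin2 => /lt0r_neq0 + /eqP eq1; apply/negP; rewrite negbK.
by rewrite -sqrf_eq0; apply/eqP; lra.
Qed.

(** Orthogonality of characters: for m nonzero this is a geometric series whose
    ratio z satisfies z ^ N = 1 and, because |m| < N, z <> 1. *)
Lemma sum_circle (R : realType) (N : nat) (m : int) : `|m| < N%:Z ->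
  \sum_(a < N) circle (a%:R / N%:R * m%:~R : R) = if m == 0 then N%:R else 0.
Proof.
case: N => [|N] ltmN; first by rewrite ltNge normr_ge0 in ltmN.
have [->|m0] := eqVneq m 0.
  under eq_bigr do rewrite mulr0 circle0.
  by rewrite sumr_const card_ord.
pose z := circle (m%:~R / N.+1%:R : R).
have z1 : z != 1.
  apply: circle_neq1; rewrite normr_gt0 mulf_neq0 ?intr_eq0 ?invr_eq0 ?pnatr_eq0//=.
  rewrite normrM normfV -intr_norm normr_nat ltr_pdivrMr ?ltr0n// mul1r.
  by rewrite -[N.+1%:R]/((N.+1%:Z)%:~R) ltr_int.
have eq_pow (a : 'I_N.+1) : circle (a%:R / N.+1%:R * m%:~R : R) = z ^+ a.
  by rewrite -circleMn; congr circle; ring.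
under eq_bigr do rewrite eq_pow.
apply: (mulfI (_ : z - 1 != 0)); first by rewrite subr_eq0.
rewrite mulr0 -subrX1 -circleMn mulrC divfK ?pnatr_eq0//.
by rewrite circle_int subrr.
Qed.

(** * A trigonometric bump *)

(** This is sin^2 (pi x): it vanishes on the integers and peaks halfway between
    them. *)
Definition bump (R : realType) (x : R) : R := (1 - cos (x * (pi *+ 2))) / 2.

Lemma bump_ge0 (R : realType) (x : R) : 0 <= bump x.
Proof. by rewrite divr_ge0// subr_ge0 cos_le1. Qed.

Lemma bump_le1 (R : realType) (x : R) : bump x <= 1.
Proof. by rewrite /bump; have := cos_geN1 (x * (pi *+ 2)); lra. Qed.

Lemma lt_bump (R : realType) : {in `[0, 2^-1 : R] &, {mono @bump R : x y / x < y}}.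
Proof.
move=> x y; rewrite !in_itv => /andP[x0 x1] /andP[y0 y1].
rewrite /bump ltr_pM2r ?invr_gt0// ltrD2l ltrN2.
have pi2 : 0 < pi *+ 2 :> R by rewrite mulrn_wgt0 ?pi_gt0.
have in0pi (z : R) : 0 <= z -> z <= 2^-1 -> z * (pi *+ 2) \in `[0, pi].
  move=> z0 z1; rewrite in_itv /= mulr_ge0 ?(ltW pi2)//=.
  by rewrite -mulr_natl mulrA ler_piMl ?pi_ge0//; lra.
by rewrite ltr_cos ?in0pi// ltr_pM2r.
Qed.

Lemma bump_circle (R : realType) (x : R) :
  ((bump x)%:C)%C = - (1 - circle x) ^+ 2 / circle x / 4.
Proof.
have -> : ((bump x)%:C)%C = (1 - (circle x + circle (- x)) / 2) / 2.
  rewrite /circle mulNr cosN sinN /bump.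
  apply/eqP; rewrite eq_complex /=; simpc.
  by rewrite andbT; apply/eqP; field.
by rewrite circleN; field; rewrite circle_neq0.
Qed.

(** The coefficient of frequency r - L in the L-th power of the bump; the range of
    r is shifted by L so as to stay in the natural numbers. *)
Definition bump_coef (R : realType) (L r : nat) : R[i] :=
  (-1) ^+ (L + r) * ('C(L.*2, r))%:R / 4 ^+ L.

(** With z the value of the character, the bump is - (1 - z)^2 / (4 z); expand
    (1 - z)^(2L) by the binomial theorem. *)
Lemma bump_fourier (R : realType) (L : nat) (x : R) :
  ((bump x)%:C)%C ^+ L =
  \sum_(r < (L.*2).+1) bump_coef R L r * circle ((r%:R - L%:R) * x).
Proof.
rewrite bump_circle expr_div_n expr_div_n exprNn -exprM mul2n exprDn.
rewrite !(mulr_sumr, mulr_suml); apply: eq_bigr => r _.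
rewrite !expr1n ?(mulr1, mul1r) (exprNn (circle x)) mulrBl circleD circleN !circleMn.
rewrite /bump_coef (exprD (-1)) -[_ *+ 'C(_, _)]mulr_natr; ring.
Qed.

(** * Vectors without small integer relations *)

Definition independent_up_to (k L : nat) (n : 'rV[int]_k) : Prop :=
  forall m : 'I_k -> int, (forall i, `|m i| <= L%:Z) ->
    \sum_i m i * n 0 i = 0 -> forall i, m i = 0.

(** Expanding the product over i yields the frequencies sum_i m_i n_i with all
    |m_i| <= L.  By independence only m = 0 gives frequency zero, and the bound
    on N keeps the other frequencies from being aliased to zero when sampling at
    the multiples of 1/N.  The phases of s disappear with them, so that the
    average does not depend on s. *)
Lemma sum_prod_bump (R : realType) (k L N : nat) (n : 'rV[int]_k) (s : 'rV[R]_k) :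
  independent_up_to L n -> \sum_i L%:Z * `|n 0 i| < N%:Z ->
  \sum_(a < N) \prod_i bump (a%:R / N%:R * (n 0 i)%:~R + s 0 i) ^+ L =
  N%:R * (('C(L.*2, L))%:R / 4 ^+ L) ^+ k.
Proof.
move=> indep ltN; apply: complexI.
pose m (f : {ffun 'I_k -> 'I_(L.*2).+1}) (i : 'I_k) : int := (f i)%:Z - L%:Z.
pose F (f : {ffun 'I_k -> 'I_(L.*2).+1}) : R[i] :=
  \prod_i (bump_coef R L (f i) * circle ((m f i)%:~R * s 0 i)).
have m_le f i : `|m f i| <= L%:Z.
  by have := ltn_ord (f i); rewrite /m; lia.
have expand (a : 'I_N) :
    ((\prod_i bump (a%:R / N%:R * (n 0 i)%:~R + s 0 i) ^+ L)%:C)%C =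
    \sum_f F f * circle (a%:R / N%:R * (\sum_i m f i * n 0 i)%:~R).
  rewrite rmorph_prod /=; under eq_bigr do rewrite rmorphXn /= bump_fourier.
  rewrite bigA_distr_bigA; apply: eq_bigr => f _.
  rewrite rmorph_sum mulr_sumr circle_sum -big_split; apply: eq_bigr => i _ /=.
  rewrite -[RHS]mulrA -circleD; congr (_ * circle _).
  by rewrite rmorphM /m rmorphB /=; ring.
rewrite rmorph_sum /=; under eq_bigr do rewrite expand.
rewrite exchange_big /=.
(* f0 is the constant choice r = L, i.e. the zero frequency vector. *)
pose f0 : {ffun 'I_k -> 'I_(L.*2).+1} := [ffun=> inord L].
have f0E i : f0 i = L :> nat by rewrite ffunE inordK// ltnS -addnn leq_addr.
rewrite (bigD1 f0)//= [X in _ + X]big1 ?addr0 => [|f f_neq]; last first.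
  rewrite -mulr_sumr sum_circle; last first.
    apply: le_lt_trans ltN; apply: le_trans (ler_norm_sum _ _ _) _.
    by apply: ler_sum => i _; rewrite normrM ler_wpM2r.
  case: eqP => [rel|_]; last by rewrite mulr0.
  case/eqP: f_neq; apply/ffunP => i; apply: val_inj; rewrite /= f0E.
  by have := indep _ (m_le f) rel i; rewrite /m; lia.
have m0 i : m f0 i = 0 by rewrite /m f0E subrr.
have sum0 : \sum_i m f0 i * n 0 i = 0 by rewrite big1 // => i _; rewrite m0 mul0r.
rewrite sum0; under eq_bigr do rewrite mulr0 circle0 mulr1.
rewrite sumr_const card_ord rmorphM rmorph_nat mulr_natl; congr (_ *+ _).
rewrite /F; under eq_bigr => i do rewrite m0 mul0r circle0 mulr1 f0E.
rewrite prodr_const card_ord /bump_coef addnn -mul2n exprM sqrrN !expr1n mul1r.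
by rewrite mul2n rmorphXn rmorphM rmorph_nat fmorphV rmorphXn rmorph_nat.
Qed.

(** * Existence of lonely times *)

(** Consecutive central binomial coefficients have ratio 2 (2L + 1) / (L + 1),
    which is at least 4 (L + 1) / (L + 2). *)
Lemma central_bin_ge (L : nat) : (4 ^ L <= L.+1 * 'C(L.*2, L))%N.
Proof.
elim: L => // L IHL.
have down := mul_bin_down L.*2.+1 L; have diag := mul_bin_diag L.*2.+2 L.
rewrite doubleS expnS; move: down diag IHL => /=.
have -> : (L.*2.+1 - L = L.+1)%N by lia.
move: (4 ^ L)%N 'C(L.*2, L) 'C(L.*2.+1, L) 'C(L.*2.+2, L.+1) => x c c1 c2.
rewrite -mul2n => down diag IHL.
have : (L.+1 * c2 = 2 * (2 * L + 1) * c)%N by nia.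
nia.
Qed.

(** Exponentials beat polynomials, from Bernoulli's inequality alone: with
    1/rho = 1 + d and L = q (k + 1), the power rho^(-L) is at least
    (q d)^(k + 1), of degree k + 1 in q, while (L + 1)^k has degree k. *)
Lemma geometric_lt_power (R : realType) (k : nat) (rho : R) : 0 < rho < 1 ->
  exists2 L : nat, (0 < L)%N & rho ^+ L < (L.+1%:R ^+ k)^-1.
Proof.
move=> /andP[rho0 rho1]; pose d := rho^-1 - 1.
have d0 : 0 < d by rewrite subr_gt0 invf_gt1.
have bernoulli (q : nat) : q%:R * d <= rho^-1 ^+ q.
  elim: q => [|q IHq]; first by rewrite mul0r expr0 ler01.
  have ge1 : 1 <= rho^-1 ^+ q by rewrite exprn_ege1// ltW// invf_gt1.
  have split_rho : rho^-1 = d + 1 by rewrite /d subrK.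
  rewrite exprS {1}split_rho mulrDl mul1r -natr1 mulrDl mul1r addrC lerD//.
  by rewrite ler_peMr// ltW.
pose C : R := (k.+1.*2)%:R ^+ k.
have [q ltq] : exists q : nat, C / d ^+ k.+1 < q%:R.
  by exists (Num.bound (C / d ^+ k.+1)); apply: archi_boundP;
    rewrite divr_ge0 ?exprn_ge0// ltW.
have q0 : (0 < q)%N.
  by rewrite -(ltr0n R); apply: le_lt_trans ltq; rewrite divr_ge0 ?exprn_ge0// ltW.
exists (q * k.+1)%N; first by rewrite muln_gt0 q0.
rewrite -[rho]invrK exprVn ltf_pV2 ?posrE ?exprn_gt0 ?invr_gt0 ?ltr0n//.
apply: (@le_lt_trans _ _ (C * q%:R ^+ k)).
  rewrite /C -exprMn -natrM lerXn2r ?nnegrE ?ler0n// ler_nat -mul2n; nia.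
rewrite exprM; apply: (@lt_le_trans _ _ ((q%:R * d) ^+ k.+1)); last first.
  have rhoV_ge0 : 0 <= rho^-1 by rewrite invr_ge0 ltW.
  by rewrite lerXn2r ?nnegrE ?bernoulli ?exprn_ge0 ?mulr_ge0 ?(ltW d0).
rewrite ltr_pdivrMr ?exprn_gt0// in ltq.
by rewrite exprMn exprS mulrAC ltr_pM2r// exprn_gt0// ltr0n.
Qed.

Lemma bump_lt (R : realType) (lambda x : R) : lambda <= 2^-1 ->
  distZ x < lambda -> bump x < bump lambda.
Proof.
move=> le_half /distZ_lt[m lt_m].
have -> : bump x = bump `|x - m%:~R|.
  suff eq_cos : cos (`|x - m%:~R| * (pi *+ 2)) = cos (x * (pi *+ 2)).
    by rewrite /bump eq_cos.
  have pi2_ge0 : 0 <= pi *+ 2 :> R by rewrite mulrn_wge0 ?pi_ge0.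
  rewrite -{1}(ger0_norm pi2_ge0) -normrM cos_norm.
  have := circleD x (- m%:~R); rewrite circleN circle_int invr1 mulr1.
  by case.
have := normr_ge0 (x - m%:~R) => ge0.
by rewrite lt_bump// in_itv /=; apply/andP; split; lra.
Qed.

(** If every sampling time fails, some factor of the product is at most rho^L at
    each of them, so that the average of the product is at most rho^L.  But that
    average is the k-th power of C(2L, L) / 4^L >= 1 / (L + 1). *)
Lemma independent_lonely (R : realType) (k : nat) (lambda : R) :
  0 < lambda < 2^-1 ->
  exists2 L : nat, (0 < L)%N & forall (n : 'rV[int]_k) (s : 'rV[R]_k),
    independent_up_to L n ->
    exists2 t, t \in `[0, 1] & lonely_time lambda n s t.
Proof.
move=> /andP[lambda0 lambda_lt].
pose rho := bump lambda.
have rho01 : 0 < rho < 1.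
  have half : bump (2^-1 : R) <= 1 by exact: bump_le1.
  have lt0 : bump (0 : R) < rho by
    rewrite lt_bump ?in_itv /=; [|apply/andP; split..]; lra.
  have lt1 : rho < bump 2^-1 by
    rewrite lt_bump ?in_itv /=; [|apply/andP; split..]; lra.
  by rewrite (le_lt_trans (bump_ge0 _) lt0) (lt_le_trans lt1 half).
have [L L0 ltL] := geometric_lt_power k rho01.
exists L => // n s indep; apply: contrapT => not_lonely.
have [N0 ltN] : exists N : nat, \sum_i L%:Z * `|n 0 i| < N.+1%:Z.
  by exists `|(\sum_i L%:Z * `|n 0 i|)%R|%N; lia.
set N := N0.+1 in ltN.
have Npos : 0 < N%:R :> R by rewrite ltr0n.
have := sum_prod_bump s indep ltN; apply/eqP; rewrite lt_eqF//.
apply: (@le_lt_trans _ _ (\sum_(a < N) rho ^+ L)).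
  apply: ler_sum => a _.
  have [i bad] : exists i, distZ (a%:R / N%:R * (n 0 i)%:~R + s 0 i) < lambda.
    apply: contrapT => good; apply: not_lonely; exists (a%:R / N%:R).
      rewrite in_itv /= divr_ge0//= ler_pdivrMr// mul1r ler_nat.
      exact: ltnW.
    by move=> i; rewrite leNgt; apply/negP => bad; apply: good; exists i.
  rewrite (bigD1 i)//= -[leRHS]mulr1 ler_pM ?exprn_ge0 ?bump_ge0//.
  - by apply: prodr_ge0 => *; rewrite exprn_ge0 ?bump_ge0.
  - by rewrite lerXn2r ?nnegrE ?bump_ge0// ltW// bump_lt// ltW.
  - by apply: prodr_ile1 => *; rewrite exprn_ge0 ?bump_ge0//=
      exprn_ile1 ?bump_ge0 ?bump_le1.
rewrite sumr_const card_ord -[ltLHS]mulr_natl ltr_pM2l//.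
apply: lt_le_trans ltL _; rewrite -exprVn lerXn2r ?nnegrE ?divr_ge0 ?exprn_ge0//.
rewrite ler_pdivlMr ?exprn_gt0// ler_pdivrMl ?ltr0n//.
by rewrite -natrX -natrM ler_nat central_bin_ge.
Qed.

(** * Counting vectors with a relation *)

Definition relation_set (k j : nat) (m : 'I_k -> int) : {set 'rV['I_j.+1]_k} :=
  [set v | \sum_i m i * int_vector v 0 i == 0]%SET.

(** Along a relation with m i0 <> 0, coordinate i0 is determined by the others.
    Hence resetting it to an arbitrary value loses no information, and the pairs
    (solution, new value) inject into the set of all vectors. *)
Lemma card_relation_le (k j : nat) (m : 'I_k -> int) (i0 : 'I_k) : m i0 != 0 ->
  (#|relation_set j m| * j.+1 <= j.+1 ^ k)%N.
Proof.
move=> mi0; set A := relation_set j m.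
pose reset (p : 'rV['I_j.+1]_k * 'I_j.+1) : 'rV['I_j.+1]_k :=
  \row_i (if i == i0 then p.2 else p.1 0 i).
have reset_inj : {in finset.setX A [set: 'I_j.+1]%SET &, injective reset}.
  move=> [v a] [w b]; rewrite !inE !andbT /= => /eqP relv /eqP relw eq_reset.
  have eqE i : (if i == i0 then a else v 0 i) = (if i == i0 then b else w 0 i).
    by have /matrixP/(_ 0 i) := eq_reset; rewrite !mxE.
  have eq_ab : a = b by have := eqE i0; rewrite eqxx.
  have eq_off i : i != i0 -> v 0 i = w 0 i.
    by move=> /negPf ne; have := eqE i; rewrite ne.
  suff eq_vw : v = w by rewrite eq_vw eq_ab.
  apply/matrixP => i' i; rewrite ord1.
  have [->|/eq_off//] := eqVneq i i0.
  move: (etrans relv (esym relw)); rewrite (bigD1 i0)//= [in RHS](bigD1 i0)//=.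
  rewrite [X in _ + X](eq_bigr (fun i => m i * int_vector w 0 i)); last first.
    by move=> l /eq_off eq_l; rewrite !mxE eq_l.
  by move/addIr/(mulfI mi0); rewrite !mxE => -[] /val_inj.
rewrite -[X in (_ * X)%N]card_ord -cardsT -cardsX.
rewrite -(card_in_imset reset_inj) (leq_trans (max_card _))//.
by rewrite card_mx card_ord mul1n.
Qed.

Definition independent_set (k L j : nat) : {set 'rV['I_j.+1]_k} :=
  [set v | `[< independent_up_to L (int_vector v) >]]%SET.

Lemma card_bigcup_le (I T : finType) (P : pred I) (A : I -> {set T}) :
  (#|(\bigcup_(i | P i) A i)%SET| <= \sum_(i | P i) #|A i|)%N.
Proof.
elim/big_rec2: _ => [|i n B _ le_Bn]; first by rewrite cards0.
by rewrite (leq_trans (leq_card_setU _ _))// leq_add2l.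
Qed.

(** Union bound over the coefficient vectors bounded by L, which are encoded as
    functions into {0, ..., 2L} after a shift by L. *)
Lemma card_dependent_le (k L j : nat) :
  (#|(~: independent_set k L j)%SET| * j.+1 <= (L.*2).+1 ^ k * j.+1 ^ k)%N.
Proof.
pose m (f : {ffun 'I_k -> 'I_(L.*2).+1}) (i : 'I_k) : int := (f i)%:Z - L%:Z.
pose B : {set {ffun 'I_k -> 'I_(L.*2).+1}} := [set f | [exists i, m f i != 0]]%SET.
have sub : (~: independent_set k L j)%SET \subset
    (\bigcup_(f in B) relation_set j (m f))%SET.
  apply/fintype.subsetP => v; rewrite !inE => /asboolPn dep.
  apply: contrapT => no_rel; apply: dep => c c_le rel i.
  apply/eqP/negPn/negP => ci0; apply: no_rel.
  pose f : {ffun 'I_k -> 'I_(L.*2).+1} := [ffun l => inord `|(c l + L%:Z)%R|%N].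
  have mE l : m f l = c l.
    have := c_le l => le_cl.
    by rewrite /m ffunE inordK; lia.
  apply/bigcupP; exists f; first by rewrite inE; apply/existsP; exists i; rewrite mE.
  by rewrite inE; apply/eqP; rewrite -[RHS]rel; apply: eq_bigr => l _; rewrite mE.
apply: leq_trans (leq_mul (subset_leq_card sub) (leqnn j.+1)) _.
apply: leq_trans (leq_mul (card_bigcup_le _ _) (leqnn j.+1)) _.
rewrite big_distrl /=.
apply: (@leq_trans (\sum_(f in B) j.+1 ^ k)%N).
  by apply: leq_sum => f; rewrite inE => /existsP; case=> i; apply: card_relation_le.
rewrite sum_nat_const leq_mul2r (leq_trans (max_card _)) ?orbT//.
by rewrite card_ffun !card_ord.
Qed.

(** Equal entries and zero entries are the relations v_i1 - v_i2 = 0 and v_i = 0,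
    whose coefficients are bounded by 1. *)
Lemma independent_set_sub_distinct (k L j : nat) : (0 < L)%N ->
  independent_set k L j \subset distinct_vectors k j.
Proof.
move=> L0; apply/fintype.subsetP => v; rewrite finset.in_set => /asboolP indep.
rewrite finset.in_set.
have sum_delta (i : 'I_k) :
    \sum_l (l == i)%:Z * int_vector v 0 l = int_vector v 0 i.
  rewrite (bigD1 i)//= big1 ?addr0 ?eqxx ?mul1r//.
  by move=> l /negPf ->; rewrite mul0r.
apply/andP; split.
  apply/injectiveP => i1 i2 eq_v; apply/eqP/negPn/negP => ne.
  have := indep (fun l => (l == i1)%:Z - (l == i2)%:Z) _ _ i1.
  rewrite eqxx (negPf ne) subr0 => one0.
  suff : 1 = 0 :> int by [].
  apply: one0 => [l|]; first by case: eqP; case: eqP => _ _ /=; lia.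
  under eq_bigr do rewrite mulrBl.
  by rewrite sumrB !sum_delta !mxE eq_v subrr.
apply/forallP => i; rewrite lt0n; apply/negP => /eqP vi0.
have := indep (fun l => (l == i)%:Z) _ _ i; rewrite eqxx => one0.
suff : 1 = 0 :> int by [].
apply: one0 => [l|]; first by case: eqP => _ /=; lia.
by rewrite sum_delta mxE vi0.
Qed.

(** * The limit *)

Lemma prob_distinct_le1 (R : realType) (k j : nat) (E : set 'rV[int]_k) :
  prob_distinct R j E <= 1.
Proof.
have [D0|D_gt0] := posnP #|distinct_vectors k j|.
  by rewrite /prob_distinct D0 invr0 mulr0 ler01.
rewrite ler_pdivrMr ?ltr0n// mul1r ler_nat.
by apply: subset_leq_card; apply/fintype.subsetP => v; rewrite inE => /andP[].
Qed.

(** The independent vectors are favourable and distinct; enlarging the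
    denominator from the distinct vectors to all (j + 1)^k vectors only decreases
    the ratio, and reduces the claim to [card_dependent_le]. *)
Lemma prob_distinct_ge (R : realType) (k L j : nat) (E : set 'rV[int]_k) :
  (0 < L)%N -> (forall n, independent_up_to L n -> E n) ->
  1 - ((L.*2).+1 ^ k)%:R * harmonic j <= prob_distinct R j E.
Proof.
move=> L0 subE; set G := independent_set k L j; set D := distinct_vectors k j.
have cardG : (#|G| + #|(~: G)%SET| = j.+1 ^ k)%N.
  by rewrite cardsC card_mx card_ord mul1n.
have T0 : 0 < (j.+1 ^ k)%:R :> R by rewrite ltr0n expn_gt0.
apply: (@le_trans _ _ (#|G|%:R / (j.+1 ^ k)%:R)).
  have -> : (#|G|%:R : R) = (j.+1 ^ k)%:R - #|(~: G)%SET|%:R.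
    by rewrite -cardG natrD addrK.
  rewrite mulrBl divff ?gt_eqF// lerD2l lerN2 ler_pdivrMr//.
  rewrite /harmonic mulrAC ler_pdivlMr ?ltr0n// -!natrM ler_nat.
  exact: card_dependent_le.
have GD : (#|G| <= #|D|)%N by apply/subset_leq_card/independent_set_sub_distinct.
have [D0|D_gt0] := posnP #|D|.
  have G0 : #|G| = 0%N by lia.
  by rewrite /prob_distinct -/D D0 invr0 G0 mulr0 mul0r.
rewrite ler_pM ?invr_ge0 ?ler0n//.
  rewrite ler_nat; apply/subset_leq_card/fintype.subsetP => v vG; rewrite inE.
  rewrite (fintype.subsetP (independent_set_sub_distinct k j L0))//=.
  by apply/asboolP/subE; move: vG; rewrite finset.in_set => /asboolP.
rewrite lef_pV2 ?posrE ?ltr0n ?expn_gt0// ler_nat.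
by rewrite (leq_trans (max_card _))// card_mx card_ord mul1n.
Qed.

Lemma prob_distinct_cvg1 (R : realType) (k L : nat) (E : set 'rV[int]_k) :
  (0 < L)%N -> (forall n, independent_up_to L n -> E n) ->
  prob_distinct R j E @[j --> \oo] --> (1 : R).
Proof.
move=> L0 subE.
apply: (@squeeze_cvgr _ _ _ _ (fun j => 1 - ((L.*2).+1 ^ k)%:R * harmonic j)
  (fun=> 1)).
- by near=> j; rewrite prob_distinct_ge//= prob_distinct_le1.
- rewrite -[X in _ --> X]subr0; apply: cvgB; first exact: cvg_cst.
  rewrite -[X in _ --> X](mulr0 ((L.*2).+1 ^ k)%:R); apply: cvgM.
    exact: cvg_cst.
  exact: cvg_harmonic.
- exact: cvg_cst.
Unshelve. all: by end_near. Qed.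

Theorem corollary3p3 (R : realType) (k : nat) (lambda gamma : R)
    (s : 'rV[R]_k) (hk : (0 < k)%N) (hlambda0 : 0 < lambda)
    (hlambda : lambda < 2^-1) (hgamma : 1 <= gamma) :
  (forall (j : nat) (v : 'rV['I_j.+1]_k), v \in distinct_vectors k j ->
     (zonotope lambda gamma (int_vector v) s `&` @integer_points R k !=set0
      <-> lambda <= lon (int_vector v) s)) /\
  (prob_distinct R j
     [set n : 'rV[int]_k |
        zonotope lambda gamma n s `&` @integer_points R k !=set0]
     @[j --> \oo] --> (1 : R)) /\
  (prob_distinct R j [set n : 'rV[int]_k | lambda <= lon n s]
     @[j --> \oo] --> (1 : R)).
Proof.
have zonP n := zonotope_integer_pointP n s (ltW hlambda) hgamma.
have [|L L0 lonely] := @independent_lonely R k lambda; first by rewrite hlambda0.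
have lon_ge n : independent_up_to L n -> lambda <= lon n s.
  by move=> indep; apply/(lon_geP n s (ltW hlambda)); apply: lonely.
split; first by move=> j v _; apply: zonP.
split; apply: (prob_distinct_cvg1 L0) => n indep //=; last exact: lon_ge.
exact/zonP/lon_ge.
Qed.
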